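(* Consider the system, the $m\ge 2$ local Kalman estimates $\hat x_1,\dots,\hat x_m$ (one per cluster) and the sequential state fusion (SSF) scheme described in the context. Suppose the $\hat x_i(k)$ are unbiased estimates of $x(k)$, with error covariance matrices $P_i(k)$. Then the SSF estimator with matrix weights is given, at each time $k$ and for $j=1,2,\dots,m-1$, by $$\hat x_{(j)}=\Delta_{1,(j)}\hat x_{(j-1)}+\Delta_{2,(j)}\hat x_{j+1},\qquad P_{(j)}=[e^{\mathrm T}\Omega_{(j)}^{-1}e]^{-1},$$ where $P_{(j)}$ is the estimation error covariance matrix of $\hat x_{(j)}$, $\hat x_{(0)}=\hat x_1$, $P_{(0)}=P_1$, and the optimal matrix weights are $$\begin{bmatrix}\Delta_{1,(j)}^{\mathrm T}\\ \Delta_{2,(j)}^{\mathrm T}\end{bmatrix}=\Omega_{(j)}^{-1}e\,[e^{\mathrm T}\Omega_{(j)}^{-1}e]^{-1},\qquad \Omega_{(j)}=\begin{bmatrix}P_{(j-1)}&P_{(j-1),j+1}\\ P_{(j-1),j+1}^{\mathrm T}&P_{j+1}\end{bmatrix},\qquad e=\begin{bmatrix}I\\ I\end{bmatrix}.$$ Here $P_{(j-1),j+1}=\mathbf{E}\{\tilde x_{(j-1)}\tilde x_{j+1}^{\mathrm T}\}$ is the cross covariance matrix of $\hat x_{(j-1)}$ and $\hat x_{j+1}$, and it satisfies $$P_{(j-1),j+1}(k)=\sum_{d=1}^{j}\left(\prod_{l=1}^{j-d}\Delta_{1,(j-l)}\right)\Delta_{2,(d-1)}\,P_{d,j+1}(k),$$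 with $\Delta_{1,(0)}=\Delta_{2,(0)}=I$ and $P_{(0),2}=P_{1,2}$, where for $j\ne d$ in $\{1,\dots,m\}$ the cross covariances $P_{j,d}(k)=\mathbf{E}\{\tilde x_j(k)\tilde x_d^{\mathrm T}(k)\}$ satisfy, for $k\ge1$, $$P_{j,d}(k)=[I-K_j(k)C(k)]\left[A(k-1)P_{j,d}(k-1)A^{\mathrm T}(k-1)+B(k-1)Q_\omega B^{\mathrm T}(k-1)\right][I-K_d(k)C(k)]^{\mathrm T}.$$ The fused state estimate and its error covariance are $\hat x_f^s=\hat x_{(m-1)}$ and $P_f^s=P_{(m-1)}$, and $$P_f^s\le P_i,\qquad i=1,2,\dots,m.$$
   Context: System: $x(k+1)=A(k)x(k)+B(k)\omega(k)$, $x(k)\in\mathbb{R}^{n_x}$, with $\omega$ a zero-mean white Gaussian noise of covariance $Q_\omega$. Clusters: there are $m$ clusters of sensors. Sensor $i$ of cluster $s$ measures $y_{s,i}(k)=C(k)x(k)+\upsilon_{s,i}(k)$, where the $\upsilon_{s,i}$ are zero-mean white Gaussian noises with positive definite covariances $R_{s,i}$, mutually uncorrelated (over all sensors and clusters) and uncorrelated with $\omega$. Cluster $s$ (with $n_s$ sensors) forms the fused measurement $$y_{f,s}(k)=R_{f,s}\sum_{i=1}^{n_s}R_{s,i}^{-1}y_{s,i}(k)=C(k)x(k)+\upsilon_{f,s}(k),\qquad R_{f,s}=\left[\sum_{i=1}^{n_s}R_{s,i}^{-1}\right]^{-1},$$ so that $\upsilon_{f,s}$ has covariance $R_{f,s}$.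 The local estimate of cluster $s$ is the standard Kalman filter estimate based on $y_{f,s}$: $$\hat x_s(k)=A(k-1)\hat x_s(k-1)+K_s(k)\left[y_{f,s}(k)-C(k)A(k-1)\hat x_s(k-1)\right],$$ with $K_s(k)$ the corresponding (deterministic) Kalman gain. The initial state and initial local estimates are uncorrelated with all noises. Notation: $\tilde x_s=x-\hat x_s$, $P_s=\mathbf{E}\{\tilde x_s\tilde x_s^{\mathrm T}\}$, $\tilde x_{(j)}=x-\hat x_{(j)}$, $P_{(j)}=\mathbf{E}\{\tilde x_{(j)}\tilde x_{(j)}^{\mathrm T}\}$. The time argument $k$ is dropped where all quantities refer to the same time $k$. $I$ is the $n_x\times n_x$ identity. $\prod_{l=1}^{r}M_l=M_1M_2\cdots M_r$ (in this order), with empty product $I$. For symmetric matrices, $X\le Y$ means $Y-X$ is positive semidefinite. SSF scheme: the local estimates are fused one by one in the order $\hat x_1,\dots,\hat x_m$: $\hat x_{(0)}=\hat x_1$ and, for $j=1,\dots,m-1$, $\hat x_{(j)}$ is the optimal matrix-weighted fusion of $\hat x_{(j-1)}$ and $\hat x_{j+1}$ in the linear minimum variance sense, i.e. among all $M_1\hat x_{(j-1)}+M_2\hat x_{j+1}$ with $M_1,M_2\in\mathbb{R}^{n_x\times n_x}$, $M_1+M_2=I$, it is the one minimizing the trace of the estimation error covariance matrix. The joint error covariance matrices $\Omega_{(j)}$ of the pairs $(\hat x_{(j-1)},\hat x_{j+1})$ are assumed positive definite. *)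

(* Defs.v *)
From HB Require Import structures.
From mathcomp Require Import all_boot all_order all_algebra.
From mathcomp Require Import all_classical all_reals all_analysis.

Set Implicit Arguments.
Unset Strict Implicit.
Unset Printing Implicit Defensive.

Import Order.TTheory GRing.Theory Num.Theory.

Local Open Scope ring_scope.

Section SymmetricMatrices.
Context (R : realType).

Definition psdmx n (M : 'M[R]_n) : Prop :=
  M^T = M /\ forall v : 'cV[R]_n, 0 <= (v^T *m M *m v) ord0 ord0.

Definition posdefmx n (M : 'M[R]_n) : Prop :=
  M^T = M /\ forall v : 'cV[R]_n, v != 0 -> 0 < (v^T *m M *m v) ord0 ord0.

Definition loewner_le n (X Y : 'M[R]_n) : Prop := psdmx (Y - X).

End SymmetricMatrices.

Section RandomVectors.
Context d (T : measurableType d) (R : realType) (P : probability T R).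

Definition square_integrable n (X : T -> 'cV[R]_n) : Prop :=
  forall i, (fun w => X w i ord0) \in Lfun P 2%:E.

(* Entrywise expectation; [fine] is harmless on integrable entries. *)
Definition expectmx p q (X : T -> 'M[R]_(p, q)) : 'M[R]_(p, q) :=
  \matrix_(i, j) fine ('E_P[fun w => X w i j])%E.

Definition uncorrelated p q (X : T -> 'cV[R]_p) (Y : T -> 'cV[R]_q) : Prop :=
  forall i j, covariance P (fun w => X w i ord0) (fun w => Y w j ord0) = 0%E.

(* Normal law of mean m and standard deviation s. The library's [normal_prob]
   is not the Dirac mass when s = 0, so that case is set apart. *)
Definition normal_law (m s : R) (U : set R) : \bar R :=
  if s == 0 then dirac m U else normal_prob m s U.

(* A random vector is Gaussian when all linear combinations of its components
   are normal; its covariance may be singular. *)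
Definition gaussian n (X : T -> 'cV[R]_n) : Prop :=
  forall a : 'rV[R]_n, exists m s : R, forall U : set R, measurable U ->
    P [set w | U ((a *m X w) ord0 ord0)]%classic = normal_law m s U.

Record white_gaussian_noise n (Q : 'M[R]_n) (v : nat -> T -> 'cV[R]_n) : Prop := {
  noise_square_integrable : forall k, square_integrable (v k);
  noise_gaussian : forall k, gaussian (v k);
  noise_zero_mean : forall k, expectmx (v k) = 0;
  noise_covariance : forall k l,
    expectmx (fun w => v k w *m (v l w)^T) = if k == l then Q else 0 }.

(* E{(x - a)(x - b)^T}: cross covariance of the errors of the estimates a, b of x,
   and the error covariance of a when b is a. *)
Definition errcov n (x a b : T -> 'cV[R]_n) : 'M[R]_n :=
  expectmx (fun w => (x w - a w) *m (x w - b w)^T).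

Definition joint_errcov n (x a b : T -> 'cV[R]_n) : 'M[R]_(n + n) :=
  block_mx (errcov x a a) (errcov x a b) (errcov x a b)^T (errcov x b b).

Definition fusion n (M1 M2 : 'M[R]_n) (a b : T -> 'cV[R]_n) : T -> 'cV[R]_n :=
  fun w => M1 *m a w + M2 *m b w.

(* Optimality in the linear minimum variance sense of the matrix weights
   M1, M2 for the fusion of the estimates a and b of x. *)
Definition lmv_optimal n (x a b : T -> 'cV[R]_n) (M1 M2 : 'M[R]_n) : Prop :=
  M1 + M2 = 1%:M /\
  forall N1 N2 : 'M[R]_n, N1 + N2 = 1%:M ->
    \tr (errcov x (fusion M1 M2 a b) (fusion M1 M2 a b))
      <= \tr (errcov x (fusion N1 N2 a b) (fusion N1 N2 a b)).

(* Clusters are numbered from 1 to m. Stage j (1 <= j < m) fuses the result of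
   stage j - 1 with the estimate of cluster j + 1. *)
Definition ssf_scheme n (m : nat) (x : T -> 'cV[R]_n)
    (xhat xf : nat -> T -> 'cV[R]_n) : Prop :=
  xf 0%N = xhat 1%N /\
  forall j, (1 <= j < m)%N -> exists M1 M2 : 'M[R]_n,
    lmv_optimal x (xf j.-1) (xhat j.+1) M1 M2 /\
    xf j = fusion M1 M2 (xf j.-1) (xhat j.+1).

End RandomVectors.

Section Fusion.
Context (R : realType).

Definition stackI n : 'M[R]_(n + n, n) := col_mx 1%:M 1%:M.

(* Sensors of a cluster are numbered from 1 to n; r i is the noise covariance
   of sensor i. *)
Definition fused_cov p (n : nat) (r : nat -> 'M[R]_p) : 'M[R]_p :=
  invmx (\sum_(1 <= i < n.+1) invmx (r i)).

Definition fused_measurement T p (n : nat) (r : nat -> 'M[R]_p)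
    (y : nat -> T -> 'cV[R]_p) : T -> 'cV[R]_p :=
  fun w => fused_cov n r *m \sum_(1 <= i < n.+1) invmx (r i) *m y i w.

End Fusion.

Section KalmanFilter.
Context (R : realType) (nx nw ny : nat).
Context (A : nat -> 'M[R]_nx) (B : nat -> 'M[R]_(nx, nw)).
Context (C : nat -> 'M[R]_(ny, nx)).
Context (Q : 'M[R]_nw) (Rf : 'M[R]_ny).

(* One-step prediction covariance at time k + 1 from the filtering
   covariance S at time k. *)
Definition kalman_predict (k : nat) (S : 'M[R]_nx) : 'M[R]_nx :=
  A k *m S *m (A k)^T + B k *m Q *m (B k)^T.

(* Gain at time k for the prediction covariance S. *)
Definition kalman_gain_of (k : nat) (S : 'M[R]_nx) : 'M[R]_(nx, ny) :=
  S *m (C k)^T *m invmx (C k *m S *m (C k)^T + Rf).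

(* Riccati recursion for the filtering covariance, started at P0. *)
Fixpoint kalman_cov (P0 : 'M[R]_nx) (k : nat) : 'M[R]_nx :=
  if k is k'.+1 then
    let S := kalman_predict k' (kalman_cov P0 k') in
    (1%:M - kalman_gain_of k S *m C k) *m S
  else P0.

(* Gain at time k + 1. *)
Definition kalman_gain_next (P0 : 'M[R]_nx) (k : nat) : 'M[R]_(nx, ny) :=
  kalman_gain_of k.+1 (kalman_predict k (kalman_cov P0 k)).

End KalmanFilter.

(* Main.v *)
Require Import Defs.
From HB Require Import structures.
From mathcomp Require Import all_boot all_order all_algebra.
From mathcomp Require Import all_classical all_reals all_analysis.

Set Implicit Arguments.
Unset Strict Implicit.
Unset Printing Implicit Defensive.

Import Order.TTheory GRing.Theory Num.Theory.

Local Open Scope ring_scope.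

(* Once the weights sum to I, the error of M1 a + M2 b is M1 (x - a) + M2 (x - b),
   so its covariance is M Om M^T with M = [M1 M2], M e = I, and completing the
   square gives M Om M^T = S + (M - D) Om (M - D)^T with S = (e^T Om^-1 e)^-1 and
   D = S e^T Om^-1. Hence D is the unique minimizer of the trace, S is the error
   covariance, and the choices M = [I 0] and M = [0 I] show that a fusion step is
   no worse, in the Loewner order, than either of its inputs. Unrolling the error
   recursion of the fusion steps gives the cross covariances of fused and local
   estimates. For the local filters, the error at time k is a linear function of
   the initial error and of noises that are orthogonal in L^2 to the later ones,
   so only the terms in P_{j,d}(k-1) and Q survive in P_{j,d}(k). *)

(** * Square-integrable random vectors and bilinearity of their second moments *)

Section SecondMoments.
Context d (T : measurableType d) (R : realType) (P : probability T R).

Lemma Lfun_sum (p : \bar R) (I : Type) (s : seq I) (a : I -> R) (f : I -> T -> R) :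
  (1 <= p)%E -> (forall i, f i \in Lfun P p) ->
  (fun w => \sum_(i <- s) a i * f i w) \in Lfun P p.
Proof.
move=> p1 fL; have -> : (fun w => \sum_(i <- s) a i * f i w) =
    \sum_(i <- s) a i *: (f i : T -> R^o).
  by apply/funext => w; rewrite fct_sumE.
by elim/big_ind: _ => [|g h gL hL|i _]; [exact: rpred0|exact: rpredD|exact: rpredZ].
Qed.

Lemma square_integrableD n (X Y : T -> 'cV[R]_n) :
  square_integrable P X -> square_integrable P Y ->
  square_integrable P (fun w => X w + Y w).
Proof.
move=> hX hY i; have -> : (fun w => (X w + Y w) i ord0) =
    (fun w => X w i ord0) \+ (fun w => Y w i ord0).
  by apply/funext => w; rewrite mxE.
by apply: rpredD (hX i) (hY i); rewrite lee1n.
Qed.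

Lemma square_integrableM p n (M : 'M[R]_(p, n)) (X : T -> 'cV[R]_n) :
  square_integrable P X -> square_integrable P (fun w => M *m X w).
Proof.
move=> hX i; have -> : (fun w => (M *m X w) i ord0) =
    (fun w => \sum_j M i j * X w j ord0).
  by apply/funext => w; rewrite mxE.
by apply: Lfun_sum => //; rewrite lee1n.
Qed.

Lemma square_integrableB n (X Y : T -> 'cV[R]_n) :
  square_integrable P X -> square_integrable P Y ->
  square_integrable P (fun w => X w - Y w).
Proof.
move=> hX hY; have -> : (fun w => X w - Y w) =
    (fun w => X w + (- 1%:M) *m Y w).
  by apply/funext => w; rewrite mulNmx mul1mx.
by apply: square_integrableD => //; apply: square_integrableM.
Qed.

Lemma square_integrable_sum n m1 m2 (X : nat -> T -> 'cV[R]_n) :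
  (forall i, (m1 <= i < m2)%N -> square_integrable P (X i)) ->
  square_integrable P (fun w => \sum_(m1 <= i < m2) X i w).
Proof.
elim: m2 => [|m2 IH] hX.
  move=> i; have -> : (fun w => (\sum_(m1 <= i < 0) X i w) i ord0) = cst 0.
    by apply/funext => w; rewrite big_geq// mxE.
  exact: Lfun_cst.
have [m12|m12] := ltnP m2 m1.
  move=> i; have -> : (fun w => (\sum_(m1 <= i < m2.+1) X i w) i ord0) = cst 0.
    by apply/funext => w; rewrite big_geq// mxE.
  exact: Lfun_cst.
have -> : (fun w => \sum_(m1 <= i < m2.+1) X i w) =
    (fun w => \sum_(m1 <= i < m2) X i w + X m2 w).
  by apply/funext => w; rewrite big_nat_recr.
apply: square_integrableD; last by apply: hX; rewrite m12 ltnSn.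
by apply: IH => i /andP[h1 h2]; apply: hX; rewrite h1 ltnS ltnW.
Qed.

(* Not centered: this is the covariance only when one of the means is zero. *)
Definition crossmom p q (X : T -> 'cV[R]_p) (Y : T -> 'cV[R]_q) : 'M[R]_(p, q) :=
  expectmx P (fun w => X w *m (Y w)^T).

Lemma crossmomE p q (X : T -> 'cV[R]_p) (Y : T -> 'cV[R]_q) i j :
  crossmom X Y i j = fine 'E_P[(fun w => X w i ord0) \* (fun w => Y w j ord0)].
Proof.
rewrite mxE; congr (fine 'E_P[_]); apply/funext => w.
by rewrite mxE big_ord_recl big_ord0 addr0 mxE.
Qed.

Lemma crossmom_tr p q (X : T -> 'cV[R]_p) (Y : T -> 'cV[R]_q) :
  (crossmom X Y)^T = crossmom Y X.
Proof.
apply/matrixP => i j; rewrite [LHS]mxE !crossmomE; congr (fine 'E_P[_]).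
by apply/funext => w /=; rewrite mulrC.
Qed.

Lemma crossmomDl p q (X X' : T -> 'cV[R]_p) (Y : T -> 'cV[R]_q) :
  square_integrable P X -> square_integrable P X' -> square_integrable P Y ->
  crossmom (fun w => X w + X' w) Y = crossmom X Y + crossmom X' Y.
Proof.
move=> hX hX' hY; apply/matrixP => i j; rewrite [RHS]mxE !crossmomE.
have XL := Lfun2_mul_Lfun1 (hX i) (hY j).
have XL' := Lfun2_mul_Lfun1 (hX' i) (hY j).
rewrite -fineD ?expectation_fin_num// -expectationD//.
by congr (fine 'E_P[_]); apply/funext => w /=; rewrite mxE mulrDl.
Qed.

Lemma crossmomMl p q r (M : 'M[R]_(r, p)) (X : T -> 'cV[R]_p) (Y : T -> 'cV[R]_q) :
  square_integrable P X -> square_integrable P Y ->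
  crossmom (fun w => M *m X w) Y = M *m crossmom X Y.
Proof.
move=> hX hY; apply/matrixP => i j; rewrite crossmomE [RHS]mxE.
have XL k := Lfun2_mul_Lfun1 (hX k) (hY j).
under [RHS]eq_bigr => k _ do rewrite crossmomE.
have -> : (fun w => (M *m X w) i ord0) \* (fun w => Y w j ord0) =
    (fun w => \sum_k M i k * ((fun w => X w k ord0) \* (fun w => Y w j ord0)) w).
  apply/funext => w /=; rewrite mxE mulr_suml.
  by apply: eq_bigr => k _; rewrite mulrA.
(* Both sides are now sums over the same index list, so induction runs over an arbitrary list. The
   [fine] of each piece may be split because products of L^2 entries are integrable. *)
elim: (index_enum _) => [|k s IH].
  rewrite big_nil -[RHS]/(fine 0%:E) -(expectation_cst P 0).
  by congr (fine 'E_P[_]); apply/funext => w; rewrite big_nil.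
rewrite big_cons -{}IH -[M i k]/(fine (M i k)%:E).
rewrite -fineM ?expectation_fin_num// -expectationZl// -fineD.
- rewrite -expectationD ?Lfun_scale// ?Lfun_sum//.
  by congr (fine 'E_P[_]); apply/funext => w /=; rewrite big_cons mulrC.
- by rewrite expectation_fin_num// Lfun_scale.
- by rewrite expectation_fin_num// Lfun_sum.
Qed.

Lemma crossmomBl p q (X X' : T -> 'cV[R]_p) (Y : T -> 'cV[R]_q) :
  square_integrable P X -> square_integrable P X' -> square_integrable P Y ->
  crossmom (fun w => X w - X' w) Y = crossmom X Y - crossmom X' Y.
Proof.
move=> hX hX' hY; have -> : (fun w => X w - X' w) =
    (fun w => X w + (- 1%:M) *m X' w).
  by apply/funext => w; rewrite mulNmx mul1mx.
rewrite crossmomDl// ?crossmomMl//; last exact: square_integrableM.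
by rewrite mulNmx mul1mx.
Qed.

Lemma crossmomDr p q (X : T -> 'cV[R]_p) (Y Y' : T -> 'cV[R]_q) :
  square_integrable P X -> square_integrable P Y -> square_integrable P Y' ->
  crossmom X (fun w => Y w + Y' w) = crossmom X Y + crossmom X Y'.
Proof.
by move=> hX hY hY'; rewrite -crossmom_tr crossmomDl// linearD /= !crossmom_tr.
Qed.

Lemma crossmomMr p q r (M : 'M[R]_(r, q)) (X : T -> 'cV[R]_p) (Y : T -> 'cV[R]_q) :
  square_integrable P X -> square_integrable P Y ->
  crossmom X (fun w => M *m Y w) = crossmom X Y *m M^T.
Proof.
by move=> hX hY; rewrite -crossmom_tr crossmomMl// trmx_mul crossmom_tr.
Qed.

Lemma crossmom_suml p q m1 m2 (X : nat -> T -> 'cV[R]_p) (Y : T -> 'cV[R]_q) :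
  (forall i, (m1 <= i < m2)%N -> square_integrable P (X i)) ->
  square_integrable P Y ->
  crossmom (fun w => \sum_(m1 <= i < m2) X i w) Y =
    \sum_(m1 <= i < m2) crossmom (X i) Y.
Proof.
move=> hX hY.
(* An empty range is written as a product by the zero matrix, so that linearity in the left argument
   gives 0. *)
have z k : (k <= m1)%N -> crossmom (fun w => \sum_(m1 <= i < k) X i w) Y = 0.
  move=> km; have -> : (fun w => \sum_(m1 <= i < k) X i w) =
      (fun w => 0 *m (0 : 'cV[R]_p)).
    by apply/funext => w; rewrite big_geq// mul0mx.
  rewrite crossmomMl ?mul0mx// => i.
  have -> : (fun=> (0 : 'cV[R]_p) i ord0) = (cst 0 : T -> R).
    by apply/funext => w; rewrite mxE.
  exact: Lfun_cst.
elim: m2 hX => [|m2 IH] hX; first by rewrite z// big_geq.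
have [m12|m12] := ltnP m2 m1; first by rewrite z// big_geq.
have hX' i : (m1 <= i < m2)%N -> square_integrable P (X i).
  by case/andP=> h1 h2; apply: hX; rewrite h1 ltnS ltnW.
rewrite big_nat_recr//= -IH// -crossmomDl//.
- by congr crossmom; apply/funext => w; rewrite big_nat_recr.
- exact: square_integrable_sum.
- by apply: hX; rewrite m12 ltnSn.
Qed.

(** Covariance is E[XY] - E[X]E[Y], and the second term vanishes as soon as one factor is centered.
    Centering falls on [Y], always a noise below, so [X] may be an initial state of nonzero mean. *)
Lemma uncorrelated_crossmom p q (X : T -> 'cV[R]_p) (Y : T -> 'cV[R]_q) :
  square_integrable P X -> square_integrable P Y -> expectmx P Y = 0 ->
  uncorrelated P X Y -> crossmom X Y = 0.
Proof.
move=> hX hY Y0 hXY; apply/matrixP => i j; rewrite [RHS]mxE crossmomE.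
have L1 (f : T -> R) : f \in Lfun P 2%:E -> f \in Lfun P 1.
  by apply: Lfun_subset12; exact: fin_num_measure.
have XL := Lfun2_mul_Lfun1 (hX i) (hY j).
have := hXY i j; rewrite covarianceE; [|exact: L1|exact: L1|exact: XL].
have -> : ('E_P[fun w => Y w j ord0] = 0)%E.
  have /matrixP/(_ j ord0) := Y0; rewrite !mxE => Yj.
  by rewrite -[LHS]fineK ?Yj// expectation_fin_num// L1.
by rewrite mule0 sube0 => /(congr1 fine).
Qed.

End SecondMoments.

(** * Positive definite matrices: congruence, inverses and traces *)

Section DefiniteMatrices.
Context (R : realType).

Lemma posdefmx_unit n (M : 'M[R]_n) : posdefmx M -> M \in unitmx.
Proof.
case=> MT Mpos; rewrite unitmxE unitfE; apply/negP => /det0P[v v0 vM].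
have /Mpos : v^T != 0 by rewrite -(inj_eq trmx_inj) trmxK trmx0.
by rewrite trmxK vM mul0mx mxE ltxx.
Qed.

Lemma posdefmx_psd n (M : 'M[R]_n) : posdefmx M -> psdmx M.
Proof.
case=> MT Mpos; split=> // v; have [->|/Mpos/ltW//] := eqVneq v 0.
by rewrite mulmx0 mxE.
Qed.

Lemma psdmx_congr n p (M : 'M[R]_n) (U : 'M[R]_(n, p)) :
  psdmx M -> psdmx (U^T *m M *m U).
Proof.
case=> MT Mpos; split; first by rewrite !trmx_mul trmxK MT mulmxA.
by move=> v; have := Mpos (U *m v); rewrite trmx_mul !mulmxA.
Qed.

Lemma posdefmx_congr n p (M : 'M[R]_n) (U : 'M[R]_(n, p)) :
  (forall v : 'cV_p, U *m v = 0 -> v = 0) ->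
  posdefmx M -> posdefmx (U^T *m M *m U).
Proof.
move=> Uinj Mpd; split; first by have [] := psdmx_congr U (posdefmx_psd Mpd).
move=> v v0; have := Mpd.2 (U *m v); rewrite trmx_mul !mulmxA; apply.
by apply: contra_neq v0; exact: Uinj.
Qed.

(** By symmetry the inverse is itself a congruence of [M], namely by the injective matrix
    [invmx M]. *)
Lemma posdefmx_inv n (M : 'M[R]_n) : posdefmx M -> posdefmx (invmx M).
Proof.
move=> Mpd; have Mu := posdefmx_unit Mpd.
have -> : invmx M = (invmx M)^T *m M *m invmx M.
  by rewrite trmx_inv Mpd.1 mulVmx// mul1mx.
apply: posdefmx_congr => // v /(congr1 (mulmx M)).
by rewrite mulKVmx// mulmx0.
Qed.

Lemma posdefmxD n (M N : 'M[R]_n) : posdefmx M -> posdefmx N -> posdefmx (M + N).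
Proof.
move=> [MT Mpos] [NT Npos]; split; first by rewrite linearD /= MT NT.
by move=> v v0; rewrite mulmxDr mulmxDl mxE addr_gt0 ?Mpos ?Npos.
Qed.

Lemma posdefmx_sum n k (M : nat -> 'M[R]_n) :
  (1 <= k)%N -> (forall i, (1 <= i <= k)%N -> posdefmx (M i)) ->
  posdefmx (\sum_(1 <= i < k.+1) M i).
Proof.
case: k => // k _; elim: k => [|k IH] hM; first by rewrite big_nat1; exact: hM.
rewrite big_nat_recr//=; apply: posdefmxD; last by apply: hM; rewrite leqnn.
by apply: IH => i /andP[h1 h2]; apply: hM; rewrite h1 ltnW.
Qed.

Lemma congr_diag n p (M : 'M[R]_n) (N : 'M[R]_(p, n)) i :
  (N *m M *m N^T) i i = (((row i N)^T)^T *m M *m (row i N)^T) ord0 ord0.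
Proof.
by rewrite trmxK -!row_mul tr_row [RHS]mxE [LHS]mxE [RHS]mxE;
  apply: eq_bigr => k _; congr (_ * _); rewrite !mxE.
Qed.

Lemma psdmx_trace_ge0 n p (M : 'M[R]_n) (N : 'M[R]_(p, n)) :
  psdmx M -> 0 <= \tr (N *m M *m N^T).
Proof. by case=> _ Mpos; apply: sumr_ge0 => i _; rewrite congr_diag. Qed.

(** The trace is the sum of the values of the quadratic form of [M] at the rows of [N]; these are
    nonnegative, so each is 0 and definiteness kills each row. This is the source of uniqueness of
    the optimal weights. *)
Lemma posdefmx_trace_eq0 n p (M : 'M[R]_n) (N : 'M[R]_(p, n)) :
  posdefmx M -> \tr (N *m M *m N^T) <= 0 -> N = 0.
Proof.
move=> Mpd tr0; have [_ Mpos] := posdefmx_psd Mpd.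
have /eqP : \tr (N *m M *m N^T) = 0.
  by apply/le_anti; rewrite tr0 psdmx_trace_ge0//; exact: posdefmx_psd.
rewrite psumr_eq0 => [/allP N0|i _]; last by rewrite congr_diag.
apply/row_matrixP => i; rewrite row0; apply: trmx_inj; rewrite trmx0.
apply: contraTeq (N0 i (mem_index_enum _)) => Ni /=.
by rewrite congr_diag gt_eqF// Mpd.2.
Qed.

End DefiniteMatrices.

(** * Best linear unbiased estimation with a general design matrix *)

Section WeightedLeastSquares.
Context (R : realType) (N n : nat) (Om : 'M[R]_N) (e : 'M[R]_(N, n)).
Hypothesis Om_pd : posdefmx Om.
Hypothesis e_inj : forall v : 'cV[R]_n, e *m v = 0 -> v = 0.

(** The Gauss-Markov estimator for observations [e] theta + noise, the noise having covariance [Om]: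
    this is its error covariance, and [blue_weight] is the matrix applied to the observations.
    Unbiasedness of a weight [M] is the constraint [M *m e = 1%:M]. *)
Definition blue_cov : 'M[R]_n := invmx (e^T *m invmx Om *m e).
Definition blue_weight : 'M[R]_(n, N) := blue_cov *m e^T *m invmx Om.

Let Om_unit := posdefmx_unit Om_pd.
Let info_pd := posdefmx_congr e_inj (posdefmx_inv Om_pd).

Lemma info_unit : e^T *m invmx Om *m e \in unitmx.
Proof. exact: posdefmx_unit. Qed.

Lemma blue_cov_tr : blue_cov^T = blue_cov.
Proof. exact: (posdefmx_inv info_pd).1. Qed.

Lemma blue_weightK : blue_weight *m e = 1%:M.
Proof.
by rewrite /blue_weight -!mulmxA (mulmxA e^T) mulVmx// info_unit.
Qed.

Lemma blue_weight_tr : blue_weight^T = invmx Om *m e *m blue_cov.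
Proof. by rewrite !trmx_mul trmxK trmx_inv Om_pd.1 blue_cov_tr mulmxA. Qed.

(* Completion of the square; the mixed terms [D Om M^T] and [M Om D^T] both
   reduce to [blue_cov] because of the constraint [M e = I]. *)
Lemma blue_decomp (M : 'M[R]_(n, N)) : M *m e = 1%:M ->
  M *m Om *m M^T = blue_cov + (M - blue_weight) *m Om *m (M - blue_weight)^T.
Proof.
move=> Me.
have OmD : Om *m blue_weight^T = e *m blue_cov.
  by rewrite blue_weight_tr !mulmxA mulmxV// mul1mx.
have DOm : blue_weight *m Om = blue_cov *m e^T by rewrite mulmxKV.
have DMt : blue_weight *m Om *m M^T = blue_cov.
  by rewrite DOm -mulmxA -trmx_mul Me trmx1 mulmx1.
have MDt : M *m Om *m blue_weight^T = blue_cov.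
  by rewrite -mulmxA OmD mulmxA Me mul1mx.
have DDt : blue_weight *m Om *m blue_weight^T = blue_cov.
  by rewrite -mulmxA OmD mulmxA blue_weightK mul1mx.
(* Three of the four expanded products equal [blue_cov], so the residual form is [M *m Om *m M^T]
   minus one copy of it. *)
rewrite linearB /= mulmxBr !mulmxBl DMt MDt DDt subrr subr0.
by rewrite addrC subrK.
Qed.

Lemma blue_weight_cov : blue_weight *m Om *m blue_weight^T = blue_cov.
Proof.
by rewrite (blue_decomp blue_weightK) subrr !mul0mx addr0.
Qed.

Lemma blue_cov_le (M : 'M[R]_(n, N)) : M *m e = 1%:M ->
  loewner_le blue_cov (M *m Om *m M^T).
Proof.
move=> Me; rewrite /loewner_le (blue_decomp Me) addrC addKr.
rewrite -{1}[M - _]trmxK; apply: psdmx_congr; exact: posdefmx_psd.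
Qed.

Lemma blue_trace_le (M : 'M[R]_(n, N)) : M *m e = 1%:M ->
  \tr blue_cov <= \tr (M *m Om *m M^T).
Proof.
move=> Me; rewrite (blue_decomp Me) mxtraceD lerDl psdmx_trace_ge0//.
exact: posdefmx_psd.
Qed.

(** The excess of the trace over its minimum is the trace of the residual form in [M - blue_weight];
    if that is not positive, definiteness of [Om] makes the residual zero. *)
Lemma blue_trace_eq (M : 'M[R]_(n, N)) : M *m e = 1%:M ->
  \tr (M *m Om *m M^T) <= \tr blue_cov -> M = blue_weight.
Proof.
move=> Me; rewrite (blue_decomp Me) mxtraceD gerDl => /(posdefmx_trace_eq0 Om_pd).
by move/subr0_eq.
Qed.

End WeightedLeastSquares.

(** * One fusion step of two estimates *)

Section Fusion.
Context d (T : measurableType d) (R : realType) (P : probability T R) (n : nat).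
Context (x a b : T -> 'cV[R]_n).
Hypothesis a_L2 : square_integrable P (fun w => x w - a w).
Hypothesis b_L2 : square_integrable P (fun w => x w - b w).

Lemma fusion_error M1 M2 : M1 + M2 = 1%:M ->
  (fun w => x w - fusion M1 M2 a b w) =
  (fun w => M1 *m (x w - a w) + M2 *m (x w - b w)).
Proof.
move=> M12; apply/funext => w; rewrite /fusion !mulmxBr addrACA -mulmxDl M12.
by rewrite mul1mx opprD.
Qed.

Lemma fusion_error_L2 M1 M2 : M1 + M2 = 1%:M ->
  square_integrable P (fun w => x w - fusion M1 M2 a b w).
Proof.
by move=> M12; rewrite fusion_error//; apply: square_integrableD;
  apply: square_integrableM.
Qed.

Lemma errcov_fusion M1 M2 : M1 + M2 = 1%:M ->
  errcov P x (fusion M1 M2 a b) (fusion M1 M2 a b) =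
  row_mx M1 M2 *m joint_errcov P x a b *m (row_mx M1 M2)^T.
Proof.
move=> M12; rewrite -[LHS]/(crossmom P (fun w => x w - fusion M1 M2 a b w)
  (fun w => x w - fusion M1 M2 a b w)) (fusion_error M12).
have aM := square_integrableM M1 a_L2; have bM := square_integrableM M2 b_L2.
rewrite crossmomDl ?crossmomDr ?crossmomMl ?crossmomMr//; last first.
  exact: square_integrableD.
rewrite /joint_errcov [(errcov _ _ _ _)^T]crossmom_tr mul_row_block tr_row_mx.
rewrite mul_row_col !mulmxDl !mulmxA addrACA.
by rewrite -!addrA; congr (_ + _); rewrite addrCA.
Qed.

(** One step of the recursion for the cross covariances of fused and local estimates; [Z] will be
    the error of a local estimate that enters at a later stage. *)
Lemma crossmom_fusion p (Z : T -> 'cV[R]_p) M1 M2 : M1 + M2 = 1%:M ->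
  square_integrable P Z ->
  crossmom P (fun w => x w - fusion M1 M2 a b w) Z =
  M1 *m crossmom P (fun w => x w - a w) Z + M2 *m crossmom P (fun w => x w - b w) Z.
Proof.
move=> M12 Z_L2; rewrite fusion_error//.
rewrite (crossmomDl (square_integrableM M1 a_L2) (square_integrableM M2 b_L2))//.
by rewrite !crossmomMl.
Qed.

Let e := stackI R n.

Lemma stackI_inj (v : 'cV[R]_n) : e *m v = 0 -> v = 0.
Proof. by rewrite /e /stackI mul_col_mx mul1mx -[RHS]col_mx0 => /eq_col_mx[]. Qed.

Lemma row_mx_stackI (M1 M2 : 'M[R]_n) : row_mx M1 M2 *m e = M1 + M2.
Proof. by rewrite mul_row_col !mulmx1. Qed.

Hypothesis Om_pd : posdefmx (joint_errcov P x a b).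
Let S := blue_cov (joint_errcov P x a b) e.
Let D := blue_weight (joint_errcov P x a b) e.

Lemma blue_weight_sum : lsubmx D + rsubmx D = 1%:M.
Proof. by rewrite -row_mx_stackI hsubmxK blue_weightK//; exact: stackI_inj. Qed.

Lemma errcov_optimal :
  errcov P x (fusion (lsubmx D) (rsubmx D) a b) (fusion (lsubmx D) (rsubmx D) a b)
  = S.
Proof.
rewrite errcov_fusion ?blue_weight_sum// hsubmxK blue_weight_cov//.
exact: stackI_inj.
Qed.

Lemma lmv_optimalP M1 M2 :
  lmv_optimal P x a b M1 M2 <-> M1 = lsubmx D /\ M2 = rsubmx D.
Proof.
split=> [[M12 Mopt]|[-> ->]].
  (* Competing against [D], whose trace is the minimum, puts the trace of [[M1 M2]] at or below that
     minimum, and the minimizer is unique. *)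
  have := Mopt _ _ blue_weight_sum; rewrite errcov_optimal errcov_fusion//.
  move/(blue_trace_eq Om_pd stackI_inj); rewrite row_mx_stackI => /(_ M12) eD.
  by rewrite /D -eD row_mxKl row_mxKr.
split=> [|N1 N2 N12]; first exact: blue_weight_sum.
rewrite errcov_optimal errcov_fusion// blue_trace_le ?row_mx_stackI//.
exact: stackI_inj.
Qed.

Lemma errcov_optimal_le : loewner_le S (errcov P x a a) /\ loewner_le S (errcov P x b b).
Proof.
split.
- have := blue_cov_le Om_pd stackI_inj (M := row_mx 1%:M 0).
  rewrite row_mx_stackI addr0 => /(_ erefl).
  rewrite tr_row_mx mul_row_block mul_row_col trmx1 trmx0.
  by rewrite !mul0mx !mulmx0 !addr0 mul1mx mulmx1.
- have := blue_cov_le Om_pd stackI_inj (M := row_mx 0 1%:M).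
  rewrite row_mx_stackI add0r => /(_ erefl).
  rewrite tr_row_mx mul_row_block mul_row_col trmx1 trmx0.
  by rewrite !mul0mx !mulmx0 !add0r mul1mx mulmx1.
Qed.

End Fusion.

(** * The Loewner order, and the closed form of a linear recursion *)

Lemma loewner_le_trans (R : realType) n (X Y Z : 'M[R]_n) :
  loewner_le X Y -> loewner_le Y Z -> loewner_le X Z.
Proof.
move=> [XYt XY] [YZt YZ]; rewrite /loewner_le -(subrK Y Z) -addrA; split.
  by rewrite linearD /= XYt YZt.
by move=> v; rewrite mulmxDr mulmxDl mxE addr_ge0.
Qed.

Lemma loewner_le_refl (R : realType) n (X : 'M[R]_n) : loewner_le X X.
Proof.
by rewrite /loewner_le subrr; split=> [|v]; rewrite ?trmx0// mulmx0 mul0mx mxE.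
Qed.

(** Each new stage multiplies all earlier terms on the left by the newest [D1] and adds a term with
    an empty product. The convention [D2 0 = 1] turns the initial value [L 1] into the term c =
    1. *)
Lemma unroll_recursion (R : realType) n p (m : nat) (D1 D2 : nat -> 'M[R]_n)
    (G L : nat -> 'M[R]_(n, p)) :
  D2 0%N = 1%:M -> G 0%N = L 1%N ->
  (forall j, (1 <= j < m)%N -> G j = D1 j *m G j.-1 + D2 j *m L j.+1) ->
  forall j, (1 <= j <= m)%N ->
    G j.-1 = \sum_(1 <= c < j.+1)
      (\prod_(1 <= l < (j - c).+1) D1 (j - l)%N) *m D2 c.-1 *m L c.
Proof.
move=> D20 G0 GS [//|r] /=; elim: r => [|r IH] rm.
  by rewrite big_nat1 big_geq//= D20 G0 !mul1mx.
rewrite big_nat_recr//= subnn [X in _ + X *m _ *m _]big_geq// mul1mx GS// IH 1?ltnW//.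
congr (_ + _); rewrite mulmx_sumr; apply: eq_big_nat => c /andP[_ cr].
rewrite !mulmxA; congr (_ *m _ *m _).
(* The factor l = 1 of the longer product is the newest weight [D1 r.+1]; shifting l by one in the
   others gives back the shorter product. *)
by rewrite [in RHS]subSn// [RHS]big_nat_recl//= subSS subn0.
Qed.

(** * Fusion of the measurements within a cluster *)

Section FusedMeasurement.
Context d (T : measurableType d) (R : realType) (P : probability T R).
Context (p n : nat) (r : nat -> 'M[R]_p).

(** The coefficients of the fused measurement sum to I, so the common signal [z] passes through
    unchanged. Having at least one sensor makes the information sum positive definite, hence
    invertible. *)
Lemma fused_measurementE (u v : nat -> T -> 'cV[R]_p) (z : T -> 'cV[R]_p) w :
  (1 <= n)%N -> (forall i, (1 <= i <= n)%N -> posdefmx (r i)) ->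
  (forall i, (1 <= i <= n)%N -> u i w = z w + v i w) ->
  fused_measurement n r u w = z w + fused_measurement n r v w.
Proof.
move=> n1 rpd huv; have infopd : posdefmx (\sum_(1 <= i < n.+1) invmx (r i)).
  by apply: posdefmx_sum => // i hi; apply: posdefmx_inv; exact: rpd.
rewrite /fused_measurement (eq_big_nat _ _
  (F2 := fun i => invmx (r i) *m z w + invmx (r i) *m v i w)).
  by rewrite big_split /= -mulmx_suml mulmxDr mulKmx// posdefmx_unit.
by move=> i hi; rewrite huv// mulmxDr.
Qed.

Context (v : nat -> T -> 'cV[R]_p).
Hypothesis v_L2 : forall i, (1 <= i <= n)%N -> square_integrable P (v i).

Lemma fused_measurement_L2 : square_integrable P (fused_measurement n r v).
Proof.
apply: square_integrableM; apply: square_integrable_sum => i hi.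
by apply: square_integrableM; exact: v_L2.
Qed.

Lemma crossmom_fused_measurement q (Z : T -> 'cV[R]_q) :
  square_integrable P Z -> (forall i, (1 <= i <= n)%N -> crossmom P (v i) Z = 0) ->
  crossmom P (fused_measurement n r v) Z = 0.
Proof.
move=> Z_L2 vZ.
have rv_L2 i : (1 <= i < n.+1)%N -> square_integrable P (fun w => invmx (r i) *m v i w).
  by move=> hi; apply: square_integrableM; exact: v_L2.
rewrite crossmomMl//; last exact: square_integrable_sum.
rewrite crossmom_suml// big_nat big1 ?mulmx0// => i hi.
by rewrite crossmomMl ?vZ ?mulmx0//; exact: v_L2.
Qed.

End FusedMeasurement.

(** * Propagation of the local filtering errors *)

Section ErrorRecursion.
Context d (T : measurableType d) (R : realType) (P : probability T R).
Context (nx nw ny : nat) (A : nat -> 'M[R]_nx) (B : nat -> 'M[R]_(nx, nw)).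
Context (om : nat -> T -> 'cV[R]_nw).
Hypothesis om_L2 : forall k, square_integrable P (om k).

(** Abstract error dynamics of one filter. Here [F k] stands for I - K(k+1)C(k+1) and [K k] for
    -K(k+1): index k holds the coefficients acting at time k+1. The system matrices and [om] are
    shared by all clusters. *)
Definition error_recursion (F : nat -> 'M[R]_nx) (K : nat -> 'M[R]_(nx, ny))
    (u : nat -> T -> 'cV[R]_ny) (e : nat -> T -> 'cV[R]_nx) : Prop :=
  [/\ square_integrable P (e 0%N), forall k, square_integrable P (u k) &
      forall k, e k.+1 =
        (fun w => F k *m (A k *m e k w + B k *m om k w) + K k *m u k.+1 w)].

Lemma prediction_error_L2 k (e : T -> 'cV[R]_nx) : square_integrable P e ->
  square_integrable P (fun w => A k *m e w + B k *m om k w).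
Proof. by move=> ?; apply: square_integrableD; apply: square_integrableM. Qed.

Section OneCluster.
Context (F : nat -> 'M[R]_nx) (K : nat -> 'M[R]_(nx, ny)).
Context (u : nat -> T -> 'cV[R]_ny) (e : nat -> T -> 'cV[R]_nx).
Hypothesis he : error_recursion F K u e.

Lemma error_L2 k : square_integrable P (e k).
Proof.
case: he => e0 uL2 eS; elim: k => // k IH; rewrite eS.
by apply: square_integrableD; apply: square_integrableM => //;
  exact: prediction_error_L2.
Qed.

Lemma crossmom_error_succ p (Z : T -> 'cV[R]_p) k : square_integrable P Z ->
  crossmom P (e k.+1) Z =
    F k *m (A k *m crossmom P (e k) Z + B k *m crossmom P (om k) Z)
    + K k *m crossmom P (u k.+1) Z.
Proof.
move=> Z_L2; case: (he) => _ uL2 ->; have eL2 := error_L2 k.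
have pL2 := prediction_error_L2 k eL2.
rewrite crossmomDl ?[crossmom _ (fun w => F k *m _) _]crossmomMl ?crossmomMl//;
  try exact: square_integrableM.
by rewrite crossmomDl ?crossmomMl//; exact: square_integrableM.
Qed.

(** Unrolled, [e k] combines [e 0], the [om l] with l < k and the [u l] with 1 <= l <= k. These
    exact ranges later allow [Z] to be process noise at time k or measurement noise at time k+1. *)
Lemma crossmom_error_eq0 p (Z : T -> 'cV[R]_p) k : square_integrable P Z ->
  crossmom P (e 0%N) Z = 0 ->
  (forall l, (l < k)%N -> crossmom P (om l) Z = 0) ->
  (forall l, (1 <= l <= k)%N -> crossmom P (u l) Z = 0) ->
  crossmom P (e k) Z = 0.
Proof.
move=> Z_L2 e0; elim: k => // k IH omZ uZ.
rewrite crossmom_error_succ// IH ?omZ ?uZ ?ltnSn ?leqnn// ?mulmx0 ?addr0 ?mulmx0//.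
- by move=> l lk; rewrite omZ// ltnW.
- by move=> l /andP[l1 lk]; rewrite uZ// l1 leqW.
Qed.

End OneCluster.

(** Each error at time k+1 has three parts (old error, process noise, measurement noise), giving
    nine products; the hypotheses kill all but old error with old error and process noise with
    itself. *)
Lemma crossmom_error_pair F K u e F' K' u' e' k (Q : 'M[R]_nw) :
  error_recursion F K u e -> error_recursion F' K' u' e' ->
  crossmom P (e k) (om k) = 0 -> crossmom P (e' k) (om k) = 0 ->
  crossmom P (e k) (u' k.+1) = 0 -> crossmom P (e' k) (u k.+1) = 0 ->
  crossmom P (om k) (om k) = Q ->
  crossmom P (u k.+1) (om k) = 0 -> crossmom P (u' k.+1) (om k) = 0 ->
  crossmom P (u k.+1) (u' k.+1) = 0 ->
  crossmom P (e k.+1) (e' k.+1) =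
    F k *m (A k *m crossmom P (e k) (e' k) *m (A k)^T + B k *m Q *m (B k)^T)
    *m (F' k)^T.
Proof.
move=> he he' eo e'o eu' e'u oo uo u'o uu'.
have orth p q (X : T -> 'cV[R]_p) (Y : T -> 'cV[R]_q) :
  crossmom P X Y = 0 -> crossmom P Y X = 0.
  by move=> XY; rewrite -crossmom_tr XY trmx0.
have eL2 := error_L2 he; have e'L2 := error_L2 he'.
have uL2 : square_integrable P (u k.+1) by case: he.
have expand p (Z : T -> 'cV[R]_p) : square_integrable P Z ->
    crossmom P Z (e' k.+1) =
    (crossmom P Z (e' k) *m (A k)^T + crossmom P Z (om k) *m (B k)^T) *m (F' k)^T
    + crossmom P Z (u' k.+1) *m (K' k)^T.
  move=> Z_L2; rewrite -crossmom_tr (crossmom_error_succ he')//.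
  by rewrite linearD /= !trmx_mul linearD /= !trmx_mul !crossmom_tr.
rewrite (crossmom_error_succ he)// !expand//.
rewrite eo eu' oo uo uu' (orth _ _ _ _ e'o) (orth _ _ _ _ u'o) (orth _ _ _ _ e'u).
by rewrite !(mul0mx, mulmx0, addr0, add0r) !(mulmxDl, mulmxDr) !mulmxA.
Qed.

End ErrorRecursion.

Theorem theorem3
  (d : measure_display) (T : measurableType d) (R : realType)
  (P : probability T R)
  (nx nw ny : nat)
  (* system *)
  (A : nat -> 'M[R]_nx) (B : nat -> 'M[R]_(nx, nw)) (C : nat -> 'M[R]_(ny, nx))
  (Q : 'M[R]_nw)
  (x : nat -> T -> 'cV[R]_nx) (om : nat -> T -> 'cV[R]_nw)
  (hom : white_gaussian_noise P Q om)
  (hx : forall k w, x k.+1 w = A k *m x k w + B k *m om k w)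
  (* m clusters; sensor i of cluster s, 1 <= s <= m, 1 <= i <= ns s *)
  (m : nat) (hm : (2 <= m)%N)
  (ns : nat -> nat) (hns : forall s, (1 <= s <= m)%N -> (1 <= ns s)%N)
  (Rn : nat -> nat -> 'M[R]_ny)
  (hRn : forall s i, (1 <= s <= m)%N -> (1 <= i <= ns s)%N -> posdefmx (Rn s i))
  (v : nat -> nat -> nat -> T -> 'cV[R]_ny)
  (hv : forall s i, (1 <= s <= m)%N -> (1 <= i <= ns s)%N ->
     white_gaussian_noise P (Rn s i) (v s i))
  (hvv : forall s i t j, (1 <= s <= m)%N -> (1 <= i <= ns s)%N ->
     (1 <= t <= m)%N -> (1 <= j <= ns t)%N -> (s, i) <> (t, j) ->
     forall k l, uncorrelated P (v s i k) (v t j l))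
  (hvom : forall s i, (1 <= s <= m)%N -> (1 <= i <= ns s)%N ->
     forall k l, uncorrelated P (v s i k) (om l))
  (y : nat -> nat -> nat -> T -> 'cV[R]_ny)
  (hy : forall s i k w, (1 <= s <= m)%N -> (1 <= i <= ns s)%N ->
     y s i k w = C k *m x k w + v s i k w)
  (* fused measurements and local Kalman estimates *)
  (yf : nat -> nat -> T -> 'cV[R]_ny)
  (hyf : forall s k, (1 <= s <= m)%N ->
     yf s k = fused_measurement (ns s) (Rn s) (fun i => y s i k))
  (xhat : nat -> nat -> T -> 'cV[R]_nx)
  (K : nat -> nat -> 'M[R]_(nx, ny))
  (hK : forall s k, (1 <= s <= m)%N ->
     K s k.+1 = kalman_gain_next A B C Q (fused_cov (ns s) (Rn s))
                  (errcov P (x 0%N) (xhat s 0%N) (xhat s 0%N)) k)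
  (hxhat : forall s k w, (1 <= s <= m)%N ->
     xhat s k.+1 w = A k *m xhat s k w
       + K s k.+1 *m (yf s k.+1 w - C k.+1 *m A k *m xhat s k w))
  (* initial conditions *)
  (hx0 : square_integrable P (x 0%N))
  (hxhat0 : forall s, (1 <= s <= m)%N -> square_integrable P (xhat s 0%N))
  (hx0om : forall k, uncorrelated P (x 0%N) (om k))
  (hx0v : forall s i k, (1 <= s <= m)%N -> (1 <= i <= ns s)%N ->
     uncorrelated P (x 0%N) (v s i k))
  (hxhat0om : forall s k, (1 <= s <= m)%N -> uncorrelated P (xhat s 0%N) (om k))
  (hxhat0v : forall s t i k, (1 <= s <= m)%N -> (1 <= t <= m)%N ->
     (1 <= i <= ns t)%N -> uncorrelated P (xhat s 0%N) (v t i k))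
  (* unbiased local estimates *)
  (hunb : forall s k, (1 <= s <= m)%N ->
     expectmx P (xhat s k) = expectmx P (x k))
  (* sequential state fusion; xf j k is the j-th fused estimate at time k *)
  (xf : nat -> nat -> T -> 'cV[R]_nx)
  (hxf : forall k, ssf_scheme P m (x k) (fun s => xhat s k) (fun j => xf j k)) :
  let Pl i j k := errcov P (x k) (xhat i k) (xhat j k) in
  let Pf j k := errcov P (x k) (xf j k) (xf j k) in
  let Pc j k := errcov P (x k) (xf j.-1 k) (xhat j.+1 k) in
  let Om j k := joint_errcov P (x k) (xf j.-1 k) (xhat j.+1 k) in
  let e := stackI R nx in
  (* cross covariances of the local estimates *)
  (forall j l k, (1 <= j <= m)%N -> (1 <= l <= m)%N -> j <> l ->
     Pl j l k.+1 =
       (1%:M - K j k.+1 *m C k.+1)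
       *m (A k *m Pl j l k *m (A k)^T + B k *m Q *m (B k)^T)
       *m (1%:M - K l k.+1 *m C k.+1)^T)
  /\
  forall k, (forall j, (1 <= j < m)%N -> posdefmx (Om j k)) ->
  exists D1 D2 : nat -> 'M[R]_nx,
    [/\ [/\ D1 0%N = 1%:M, D2 0%N = 1%:M,
            xf 0%N k = xhat 1%N k, Pf 0%N k = Pl 1%N 1%N k
          & Pc 1%N k = Pl 1%N 2%N k],
        (* matrix weights *)
        (forall j, (1 <= j < m)%N ->
           [/\ e^T *m invmx (Om j k) *m e \in unitmx,
               col_mx (D1 j)^T (D2 j)^T
                 = invmx (Om j k) *m e *m invmx (e^T *m invmx (Om j k) *m e)
             & forall M1 M2 : 'M[R]_nx,
                 lmv_optimal P (x k) (xf j.-1 k) (xhat j.+1 k) M1 M2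
                 <-> M1 = D1 j /\ M2 = D2 j]),
        (* estimates and their error covariances *)
        (forall j, (1 <= j < m)%N ->
           (forall w, xf j k w = D1 j *m xf j.-1 k w + D2 j *m xhat j.+1 k w)
           /\ Pf j k = invmx (e^T *m invmx (Om j k) *m e)),
        (* cross covariances of fused and local estimates *)
        (forall j, (1 <= j < m)%N ->
           Pc j k =
             \sum_(1 <= c < j.+1)
               (\prod_(1 <= l < (j - c).+1) D1 (j - l)%N)
               *m D2 c.-1 *m Pl c j.+1 k)
      & (* the fused estimate xf m.-1 against the local ones *)
        forall i, (1 <= i <= m)%N -> loewner_le (Pf m.-1 k) (Pl i i k)].
Proof.
move=> Pl Pf Pc Om e.
have omL2 k : square_integrable P (om k) by case: hom.
have vL2 s i k : (1 <= s <= m)%N -> (1 <= i <= ns s)%N -> square_integrable P (v s i k).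
  by move=> hs hi; case: (hv _ _ hs hi).
pose er s k w := x k w - xhat s k w.
pose u s k := fused_measurement (ns s) (Rn s) (fun i => v s i k).
have uL2 s k : (1 <= s <= m)%N -> square_integrable P (u s k).
  by move=> hs; apply: fused_measurement_L2 => i hi; exact: vL2.
(* With [yf] = C x + [u], the innovation is C(x(k+1) - A xhat(k)) + [u], and x(k+1) - A xhat(k) is
   the prediction error. *)
have err s : (1 <= s <= m)%N ->
    error_recursion P A B om (fun k => 1%:M - K s k.+1 *m C k.+1)
      (fun k => - K s k.+1) (u s) (er s).
  move=> hs; split=> [|k|k]; last 2 first.
  - exact: uL2.
  - apply/funext => w; rewrite /er hxhat// hyf//.
    rewrite (fused_measurementE (v := fun i => v s i k.+1)
      (z := fun w => C k.+1 *m x k.+1 w)) => [|||i hi]; last 3 first.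
    + exact: hns.
    + by move=> i; exact: hRn.
    + exact: hy.
    have -> : A k *m (x k w - xhat s k w) + B k *m om k w
        = x k.+1 w - A k *m xhat s k w by rewrite mulmxBr addrAC hx.
    rewrite -/(u s k.+1 w) -(mulmxA (C _)) [_ + u _ _ _ - _]addrAC -mulmxBr.
    by rewrite mulmxBl mul1mx mulNmx -mulmxA mulmxDr !opprD !addrA.
  by apply: square_integrableB => //; exact: hxhat0.
have om0 k : expectmx P (om k) = 0 by case: hom.
have v0 s i k : (1 <= s <= m)%N -> (1 <= i <= ns s)%N -> expectmx P (v s i k) = 0.
  by move=> hs hi; case: (hv _ _ hs hi).
have omom k l : k <> l -> crossmom P (om k) (om l) = 0.
  by rewrite /crossmom => /eqP/negPf kl; case: hom => _ _ _ ->; rewrite kl.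
have vom s i k l : (1 <= s <= m)%N -> (1 <= i <= ns s)%N ->
    crossmom P (v s i k) (om l) = 0.
  by move=> hs hi; apply: uncorrelated_crossmom => //; [exact: vL2|exact: hvom].
(* Only pairs in the same cluster at the same time are excluded. If the sensors coincide the times
   differ, and whiteness applies; otherwise the sensors are uncorrelated. *)
have vv s i t j k l : (1 <= s <= m)%N -> (1 <= i <= ns s)%N ->
    (1 <= t <= m)%N -> (1 <= j <= ns t)%N -> s <> t \/ k <> l ->
    crossmom P (v s i k) (v t j l) = 0.
  move=> hs hi ht hj stkl; have [[est eij]|neq] := pselect ((s, i) = (t, j)).
    subst t j; case: stkl => // /eqP/negPf kl.
    by case: (hv _ _ hs hi) => _ _ _ cov; rewrite /crossmom cov kl.
  by apply: uncorrelated_crossmom; [exact: vL2|exact: vL2|exact: v0|exact: hvv].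
have uom s k l : (1 <= s <= m)%N -> crossmom P (u s k) (om l) = 0.
  by move=> hs; apply: crossmom_fused_measurement => // i hi; [exact: vL2|exact: vom].
have uv s t j k l : (1 <= s <= m)%N -> (1 <= t <= m)%N -> (1 <= j <= ns t)%N ->
    s <> t \/ k <> l -> crossmom P (u s k) (v t j l) = 0.
  move=> hs ht hj stkl; apply: crossmom_fused_measurement => [i hi||i hi].
  - exact: vL2.
  - exact: vL2.
  - exact: vv.
have xh0 s q (Z : T -> 'cV[R]_q) : (1 <= s <= m)%N -> square_integrable P Z ->
    expectmx P Z = 0 -> uncorrelated P (x 0%N) Z -> uncorrelated P (xhat s 0%N) Z ->
    crossmom P (er s 0%N) Z = 0.
  move=> hs Z_L2 Z0 xZ xhZ; rewrite crossmomBl//; last exact: hxhat0.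
  by rewrite !uncorrelated_crossmom ?subrr//; exact: hxhat0.
have erom s k l : (1 <= s <= m)%N -> (k <= l)%N -> crossmom P (er s k) (om l) = 0.
  move=> hs kl; apply: (crossmom_error_eq0 omL2 (err s hs)) => // [|i ik|i _].
  - by apply: xh0 => //; exact: hxhat0om.
  - by apply: omom => il; rewrite il ltnNge kl in ik.
  - exact: uom.
have eru s t k : (1 <= s <= m)%N -> (1 <= t <= m)%N ->
    crossmom P (er s k) (u t k.+1) = 0.
  move=> hs ht; have vZ j : (1 <= j <= ns t)%N -> crossmom P (er s k) (v t j k.+1) = 0.
    move=> hj; have vtL2 := vL2 _ _ k.+1 ht hj.
    apply: (crossmom_error_eq0 omL2 (err s hs)) => // [|i ik|i /andP[_ ik]].
    - by apply: xh0 => //; [exact: v0|exact: hx0v|exact: hxhat0v].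
    - by rewrite -crossmom_tr vom// trmx0.
    (* Only fused noises up to time k enter the error at k, so the times differ from k+1 even when s
       = t. *)
    - by apply: uv => //; right => ek; rewrite ek ltnn in ik.
  rewrite -crossmom_tr crossmom_fused_measurement ?trmx0// => [j hj||j hj].
  - exact: vL2.
  - exact: (error_L2 omL2 (err s hs)).
  - by rewrite -crossmom_tr vZ// trmx0.
split=> [j l k hj hl jl|k Om_pd].
  apply: (crossmom_error_pair omL2 (err j hj) (err l hl)); rewrite ?erom ?eru ?uom//.
    by case: hom => _ _ _ /(_ k k); rewrite eqxx.
  (* The two fused noises are taken at the same time; they are orthogonal because the clusters [j]
     and [l] are distinct. *)
  rewrite -crossmom_tr crossmom_fused_measurement ?trmx0// => [i hi||i hi].
  - exact: vL2.
  - exact: uL2.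
  - by rewrite -crossmom_tr uv ?trmx0//; left.
pose W j := blue_weight (Om j k) e.
pose D1 j := if j is 0%N then 1%:M else lsubmx (W j).
pose D2 j := if j is 0%N then 1%:M else rsubmx (W j).
have D1E j : (1 <= j < m)%N -> D1 j = lsubmx (W j) by case: j.
have D2E j : (1 <= j < m)%N -> D2 j = rsubmx (W j) by case: j.
have [xf0 xfS] := hxf k.
have erL2 s : (1 <= s <= m)%N -> square_integrable P (fun w => x k w - xhat s k w).
  by move=> hs; exact: (error_L2 omL2 (err s hs)).
have hS j : (1 <= j < m)%N -> (1 <= j.+1 <= m)%N by case/andP=> _ ->.
have h1 : (1 <= 1 <= m)%N := ltnW hm.
have xfL2 j : (j < m)%N -> square_integrable P (fun w => x k w - xf j k w).
  elim: j => [_|j IH jm]; first by rewrite xf0; exact: erL2.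
  have [//|M1 [M2 [[M12 _] ->]]] := xfS j.+1.
  by apply: fusion_error_L2 => //; [apply: IH; exact: ltnW|exact: erL2].
have stage j : (1 <= j < m)%N ->
    [/\ xf j k = fusion (D1 j) (D2 j) (xf j.-1 k) (xhat j.+1 k),
        D1 j + D2 j = 1%:M &
        square_integrable P (fun w => x k w - xf j.-1 k w)].
  move=> hj; have pL2 : square_integrable P (fun w => x k w - xf j.-1 k w).
    by apply: xfL2; case/andP: hj => _; apply: leq_ltn_trans; exact: leq_pred.
  have [M1 [M2 [opt ->]]] := xfS j hj.
  (* Uniqueness of the minimizer identifies the weights that the scheme merely asserts to exist with
     the explicit blocks of [W j]. *)
  have [e1 e2] := (lmv_optimalP pL2 (erL2 _ (hS _ hj)) (Om_pd _ hj) M1 M2).1 opt.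
  by rewrite D1E// D2E// /W -e1 -e2; split=> //; case: opt.
have PfE j : (1 <= j < m)%N -> Pf j k = blue_cov (Om j k) e.
  move=> hj; have [xfj _ pL2] := stage j hj; rewrite /Pf xfj D1E// D2E//.
  exact: errcov_optimal pL2 (erL2 _ (hS _ hj)) (Om_pd _ hj).
exists D1, D2; split.
- by split=> //; rewrite /Pf /Pc /= xf0.
- move=> j hj; have [xfj _ pL2] := stage j hj; split.
  + by apply: info_unit; [exact: Om_pd|exact: stackI_inj].
  + rewrite -tr_row_mx D1E// D2E// hsubmxK.
    by apply: blue_weight_tr; [exact: Om_pd|exact: stackI_inj].
  + by rewrite D1E// D2E//; exact: lmv_optimalP pL2 (erL2 _ (hS _ hj)) (Om_pd _ hj).
- by move=> j hj; split; [have [-> _ _] := stage j hj|exact: PfE].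
- move=> j hj; have hj' : (1 <= j <= m)%N by case/andP: hj => -> /ltnW.
  (* The local estimate [xhat j.+1] is held fixed while the stage r varies; the required cross
     covariance is the value at r = j - 1. *)
  apply: (unroll_recursion (m := m) (G := fun r => crossmom P
    (fun w => x k w - xf r k w) (fun w => x k w - xhat j.+1 k w))
    (L := fun c => Pl c j.+1 k)) => // [|r hr]; first by rewrite xf0.
  have [-> M12 pL2] := stage r hr.
  by rewrite crossmom_fusion//; apply: erL2; exact: hS.
- have Pf_le r i : (r < m)%N -> (1 <= i <= r.+1)%N -> loewner_le (Pf r k) (Pl i i k).
    elim: r => [_|r IH rm].
      by case: i => [|[|]]// _; rewrite /Pf xf0; exact: loewner_le_refl.
    have hr : (1 <= r.+1 < m)%N by [].
    have [_ _ pL2] := stage _ hr.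
    have [le1 le2] := errcov_optimal_le (Om_pd _ hr).
    (* Either i = r + 2 is the estimate just fused, or it entered earlier and the bound at stage r
       carries over by transitivity. *)
    rewrite PfE// => /andP[i1]; rewrite leq_eqVlt => /predU1P[->//|ir].
    by apply: loewner_le_trans le1 _; apply: IH; [exact: ltnW|rewrite i1].
  by move=> i hi; apply: Pf_le; rewrite prednK// ltnW.
Qed.
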